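(* Let $\mathcal{B}=(e_n)_{n=1}^\infty$ be a Schauder basis of a quasi-Banach space $\mathbb{X}$ (renormed so as to be a $p$-Banach space for some $0<p\le 1$). The following are equivalent: (a) $\mathcal{B}$ is super-strong partially greedy, i.e. there is $\mathbf{C}>0$ such that $\|x-G_m(x)\|\le\mathbf{C}\,\widehat{\widehat{\sigma}}_m(x)$ for all $x\in\mathbb{X}$, all $m\in\mathbb{N}$ and all greedy sums $G_m(x)$ of order $m$. (b) $\mathcal{B}$ is strong partially greedy, i.e. there is $\mathbf{C}>0$ such that $\|x-G_m(x)\|\le\mathbf{C}\min_{0\le n\le m}\|x-S_n(x)\|$ for all $x\in\mathbb{X}$, all $m\in\mathbb{N}$ and all $G_m(x)$. (c) $\mathcal{B}$ is partially greedy, i.e. there is $\mathbf{C}>0$ such that $\|x-G_m(x)\|\le\mathbf{C}\|x-S_m(x)\|$ for all $x\in\mathbb{X}$, all $m\in\mathbb{N}$ and all $G_m(x)$.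
   Context: Spaces are separable and infinite-dimensional over $\mathbb{F}=\mathbb{R}$ or $\mathbb{C}$. A quasi-Banach space is a vector space complete with respect to a quasi-norm (as a norm, but with $\|x+y\|\le k(\|x\|+\|y\|)$ for some constant $k>0$). By the Aoki–Rolewicz theorem it can be renormed so that $\|x+y\|^p\le\|x\|^p+\|y\|^p$ for some $0<p\le1$ (a $p$-Banach space), and this renorming is assumed throughout. Basis: a collection $\mathcal{B}=(e_n)_{n=1}^\infty\subset\mathbb{X}$ is a (semi-normalized) basis if (1) the closed linear span of $(e_n)$ is $\mathbb{X}$; (2) there is a unique sequence $(e_n^* )_{n=1}^\infty\subset\mathbb{X}^*$ with $e_j^*(e_k)=\delta_{j,k}$; (3) $0<\inf_n\{\|e_n\|,\|e_n^*\|\}\le\sup_n\{\|e_n\|,\|e_n^*\|\}<\infty$. It is a Markushevich basis if in addition the span of $(e_n^* )$ is weak$^*$-dense in $\mathbb{X}^*$, and a Schauder basis if additionally the partial sum operators $S_m(x):=\sum_{n=1}^me_n^*(x)e_n$, $m\in\mathbb{N}$, are uniformly bounded. Put $S_0(x):=0$. A set $A\subset\mathbb{N}$ is an $m$-greedy set of $x$ if $|A|=m$ and $\min_{n\in A}|e_n^*(x)|\ge\max_{n\notin A}|e_n^*(x)|$; the corresponding greedy sum of order $m$ is $G_m(x):=\sum_{n\in A}e_n^*(x)e_n$ (not necessarily unique). $\widehat{\widehat{\sigma}}_m(x):=\inf\{\|x-\sum_{n\in A}a_ne_n\|: A\subset\{1,\dots,m\},\ a_n\in\mathbb{F}\ (n\in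 A)\}$. *)

(* Defs.v *)
From mathcomp Require Import all_boot all_order all_algebra.
From mathcomp Require Import finmap complex.
From mathcomp Require Import all_classical all_reals all_analysis.
Set Implicit Arguments.
Unset Strict Implicit.
Unset Printing Implicit Defensive.
Import Order.TTheory GRing.Theory Num.Theory.
Import numFieldNormedType.Exports.
Local Open Scope classical_set_scope.
Local Open Scope ring_scope.

Variant scalar_kind := RealScalars | ComplexScalars.

Definition scalar_field (R : realType) (k : scalar_kind) : numFieldType :=
  match k with
  | RealScalars => R
  | ComplexScalars => R[i]%C
  end.

(* The modulus takes its values in R; the norm of the numFieldType R[i] would
   take them in R[i]. *)
Definition modulus (R : realType) (k : scalar_kind) : scalar_field R k -> R :=
  match k with
  | RealScalars => fun a : R => `|a|
  | ComplexScalars => fun a : R[i]%C => ComplexField.Normc.normc a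
  end.

Definition infinite_dimensional (F : numFieldType) (X : lmodType F) : Prop :=
  forall (d : nat) (v : 'I_d -> X),
    exists x, forall a : 'I_d -> F, x <> \sum_i a i *: v i.

Section QuasiBanach.
Context {R : realType} {k : scalar_kind}.
Local Notation F := (scalar_field R k).
Context {X : lmodType F}.
Variable N : X -> R.

Record quasi_norm : Prop := QuasiNorm {
  qnorm_ge0 : forall x, 0 <= N x;
  qnorm_eq0 : forall x, N x = 0 -> x = 0;
  qnormZ : forall (a : F) x, N (a *: x) = modulus a * N x;
  qnormD : exists2 c : R, 0 < c & forall x y, N (x + y) <= c * (N x + N y) }.

Definition p_convex (p : R) : Prop :=
  forall x y, N (x + y) `^ p <= N x `^ p + N y `^ p.

Definition qnorm_complete : Prop :=
  forall u : nat -> X,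
    (forall eps, 0 < eps -> \forall m & n \near \oo, N (u m - u n) < eps) ->
    exists x, N (u n - x) @[n --> \oo] --> (0 : R).

Definition qnorm_dense (D : set X) : Prop :=
  forall x eps, 0 < eps -> exists2 y, D y & N (x - y) < eps.

Definition qnorm_separable : Prop :=
  exists2 D : set X, countable D & qnorm_dense D.

Record p_banach (p : R) : Prop := PBanach {
  p_banach_qnorm : quasi_norm;
  p_banach_convex : p_convex p;
  p_banach_complete : qnorm_complete }.

(* [{scalar X}] is the type of all linear functionals on X; the dual consists of
   those that are continuous for the topology of the quasi-norm. *)
Definition in_dual (f : {scalar X}) : Prop :=
  forall x eps, 0 < eps -> exists2 delta, 0 < delta &
    forall y, N (y - x) < delta -> modulus (f y - f x) < eps.

Definition dual_norm (f : {scalar X}) : R :=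
  sup [set modulus (f x) | x in [set x | N x <= 1]].

End QuasiBanach.

(* Sequences are indexed from 0: [e n] and [es n] stand for e_{n+1} and
   e^*_{n+1}, so {1, ..., m} becomes {0, ..., m-1}. *)
Section Bases.
Context {R : realType} {k : scalar_kind}.
Local Notation F := (scalar_field R k).
Context {X : lmodType F}.
Variables (N : X -> R) (e : nat -> X) (es : nat -> {scalar X}).

Definition basis_vectors_span : set X :=
  [set w | exists n (a : nat -> F), w = \sum_(i < n) a i *: e i].

Definition biorthogonal (fs : nat -> {scalar X}) : Prop :=
  forall j l, fs j (e l) = (j == l)%:R.

(* By uniqueness, [es] is determined by [e]. *)
Record semi_normalized_basis : Prop := SemiNormalizedBasis {
  basis_span : qnorm_dense N basis_vectors_span;
  basis_dual : forall n, in_dual N (es n);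
  basis_biorth : biorthogonal es;
  basis_unique : forall fs : nat -> {scalar X},
    (forall n, in_dual N (fs n)) -> biorthogonal fs ->
    forall n, fs n =1 es n;
  basis_inf : 0 < inf (range (N \o e) `|` range (dual_norm N \o es));
  basis_sup : has_ubound (range (N \o e) `|` range (dual_norm N \o es)) }.

(* The weak* topology is the restriction to the dual of the topology of
   pointwise convergence. *)
Definition dual_span_weak_star_dense : Prop :=
  forall f : {scalar X}, in_dual N f ->
    closure ([set g | exists n (a : nat -> F),
                g = fun x => \sum_(i < n) a i * es i x] : set {ptws X -> F}) f.

Definition markushevich_basis : Prop :=
  semi_normalized_basis /\ dual_span_weak_star_dense.

Definition partial_sum (m : nat) (x : X) : X := \sum_(i < m) es i x *: e i.

Definition schauder_basis : Prop :=
  markushevich_basis /\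
  exists M : R, forall m x, N (partial_sum m x) <= M * N x.

Definition greedy_set (m : nat) (x : X) (A : {fset nat}) : Prop :=
  #|` A| = m /\
  forall i j, i \in A -> j \notin A -> modulus (es j x) <= modulus (es i x).

Definition coord_sum (A : {fset nat}) (x : X) : X :=
  \sum_(i <- A) es i x *: e i.

Definition sigma_hathat (m : nat) (x : X) : R :=
  inf [set r | exists (A : {set 'I_m}) (a : 'I_m -> F),
         r = N (x - \sum_(i in A) a i *: e i)].

(* The inequality ||x - G_m(x)|| <= C * bound m x for every x, every m >= 1 and
   every greedy sum of order m. *)
Definition greedy_bounded (bound : nat -> X -> R) : Prop :=
  exists2 C : R, 0 < C &
    forall (x : X) (m : nat) (A : {fset nat}),
      (1 <= m)%N -> greedy_set m x A ->
      N (x - coord_sum A x) <= C * bound m x.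

Definition super_strong_partially_greedy : Prop :=
  greedy_bounded sigma_hathat.

Definition strong_partially_greedy : Prop :=
  greedy_bounded (fun m x =>
    \big[Num.min/N (x - partial_sum 0 x)]_(1 <= n < m.+1)
      N (x - partial_sum n x)).

Definition partially_greedy : Prop :=
  greedy_bounded (fun m x => N (x - partial_sum m x)).

End Bases.

(* Main.v *)
Require Import Defs.
From mathcomp Require Import all_boot all_order all_algebra.
From mathcomp Require Import all_classical all_reals all_analysis.
Local Open Scope ring_scope.

(** The implications from super-strong to strong to plain partial greediness
    compare the right-hand sides: each partial sum [S_n x] with [n <= m] is one
    of the competitors in the infimum [sigma_hathat m x], and [S_m x] is one of
    those in the minimum.

    The way back rests on the projection property of partial sums.  If [y] is
    any combination of the first [m] basis vectors then [S_m y = y], so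
    [x - S_m x = (x - y) - S_m (x - y)]; as the operators [S_m] are uniformly
    bounded, [N (x - S_m x) <= K * N (x - y)] with [K] independent of [x], [y]
    and [m].  The infimum over [y] gives [N (x - S_m x) <= K * sigma_hathat m x]
    ([tail_le_sigma_hathat]), and [K] is absorbed in the greedy constant. *)

Import Order.TTheory GRing.Theory Num.Theory.
Local Open Scope classical_set_scope.

Section PartialGreediness.
Context {R : realType} {k : scalar_kind} {X : lmodType (scalar_field R k)}.
Variables (N : X -> R) (e : nat -> X) (es : nat -> {scalar X}).
Hypothesis qN : quasi_norm N.

Lemma qnormN x : N (- x) = N x.
Proof.
rewrite -scaleN1r (qnormZ qN).
suff -> : modulus (-1 : scalar_field R k) = 1 by rewrite mul1r.
case: (k) => /=; first by rewrite normrN1.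
by rewrite oppr0 expr0n /= addr0 sqrrN expr1n sqrtr1.
Qed.

Lemma partial_sumB m x y :
  partial_sum e es m (x - y) = partial_sum e es m x - partial_sum e es m y.
Proof.
rewrite /partial_sum -sumrB; apply: eq_bigr => i _.
by rewrite linearB scalerBl.
Qed.

Lemma partial_sum_id m (A : {set 'I_m}) (a : 'I_m -> scalar_field R k) :
  biorthogonal e es ->
  partial_sum e es m (\sum_(i in A) a i *: e i) = \sum_(i in A) a i *: e i.
Proof.
move=> bio; rewrite /partial_sum [RHS]big_mkcond /=.
apply: eq_bigr => j _; rewrite linear_sum /=.
under eq_bigr => i _ do rewrite linearZ /= bio.
case: ifP => jA.
  rewrite (bigD1 j) //= eqxx mulr1 big1 ?addr0 // => i /andP[_ ij].
  by rewrite [(j == i :> nat)]eq_sym (negbTE (ij : (i != j :> nat))) mulr0.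
rewrite big1 ?scale0r // => i iA.
case: (eqVneq (j : nat) i) => [/val_inj ji|_]; last by rewrite mulr0.
by rewrite ji iA in jA.
Qed.

Lemma sigma_hathat_le_partial_sum m n x : (n <= m)%N ->
  sigma_hathat N e m x <= N (x - partial_sum e es n x).
Proof.
move=> nm; apply: ge_inf; first by exists 0 => _ [A [a ->]]; exact: qnorm_ge0.
exists [set i : 'I_m | (i < n)%N]%SET, (fun i => es i x).
rewrite /partial_sum (big_ord_widen m (fun i => es i x *: e i) nm).
by congr (N (x - _)); apply: eq_bigl => i; rewrite inE.
Qed.

(** Subtracting a combination of the first [m] basis vectors leaves the tail
    [x - S_m x] unchanged, so the norm of the complementary projection controls
    the tail by the distance to any such combination. *)
Lemma tail_le_sigma_hathat (M : R) : biorthogonal e es ->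
  (forall m x, N (partial_sum e es m x) <= M * N x) ->
  exists2 K : R, 0 < K &
    forall m x, N (x - partial_sum e es m x) <= K * sigma_hathat N e m x.
Proof.
move=> bio SM; have [c c0 cD] := qnormD qN.
have K0 : 0 < c * (1 + `|M|) by rewrite mulr_gt0 // ltr_pwDl.
exists (c * (1 + `|M|)) => // m x.
rewrite -ler_pdivrMl //; apply: lb_le_inf.
  by eexists; exists finset.set0, (fun=> 0).
move=> _ [A [a ->]]; rewrite ler_pdivrMl //.
set y := \sum_(i in A) _.
have -> : x - partial_sum e es m x = (x - y) - partial_sum e es m (x - y).
  by rewrite partial_sumB partial_sum_id // opprB addrA subrK.
apply: (le_trans (cD _ _)); rewrite qnormN -mulrA ler_pM2l // mulrDl mul1r.
rewrite lerD2l; apply: (le_trans (SM _ _)).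
by rewrite ler_wpM2r ?(qnorm_ge0 qN) // ler_norm.
Qed.

Lemma greedy_bounded_le (b1 b2 : nat -> X -> R) (K : R) : 0 < K ->
  (forall m x, (1 <= m)%N -> b1 m x <= K * b2 m x) ->
  greedy_bounded N e es b1 -> greedy_bounded N e es b2.
Proof.
move=> K0 b12 [C C0 CP]; exists (C * K); first exact: mulr_gt0.
move=> x m A m1 gA; apply: (le_trans (CP x m A m1 gA)).
by rewrite -mulrA ler_pM2l // b12.
Qed.

End PartialGreediness.

Theorem mainTheorem4 (R : realType) (k : scalar_kind)
    (X : lmodType (scalar_field R k)) (N : X -> R) (p : R)
    (e : nat -> X) (es : nat -> {scalar X}) :
  0 < p <= 1 ->
  p_banach N p ->
  qnorm_separable N ->
  infinite_dimensional X ->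
  schauder_basis N e es ->
  [<-> super_strong_partially_greedy N e es;
       strong_partially_greedy N e es;
       partially_greedy N e es].
Proof.
move=> _ [qN _ _] _ _ [[[_ _ bio _ _ _] _] [M SM]].
tfae.
- apply: (greedy_bounded_le N e es _ _ 1) => // m x _; rewrite mul1r.
  rewrite big_nat; apply: (big_ind (fun r => sigma_hathat N e m x <= r)).
  + exact: sigma_hathat_le_partial_sum.
  + by move=> r s rP sP; rewrite le_min rP.
  + by move=> n /andP[_ nm]; exact: sigma_hathat_le_partial_sum.
- apply: (greedy_bounded_le N e es _ _ 1) => // m x m1; rewrite mul1r.
  by apply: ge_bigmin_seq => //; rewrite mem_index_iota m1 ltnSn.
- have [K K0 KP] := tail_le_sigma_hathat N e es qN M bio SM.
  by apply: (greedy_bounded_le N e es _ _ K).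
Qed.
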